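(* Let $n\in\mathbb N$, and let $\mathcal C^{(A)}_{n,t},\mathcal C^{(B)}_{n,t}$ and the even polynomials $\Xi_n,\Lambda_n\in\mathbb Q[x]$ be as defined in the context. Then the leading coefficients satisfy $$[x^{2n-2}]\,\Xi_n(x)=\frac{(-1)^{n+1}}{2^{2n}},\qquad [x^{2n-2}]\,\Lambda_n(x)=\frac{(-1)^{n+1}}{2^{2n+1}-1}.$$ Equivalently, $$\mathcal C^{(B)}_{n,n-1}=2^{2n-2}(2n-1)!,\qquad \mathcal C^{(A)}_{n,n-1}=\frac{(2n)!}{2}.$$
   Context: $\mathbb N=\{1,2,3,\dots\}$; $[x^j]P(x)$ denotes the coefficient of $x^j$ in $P$. Binomial coefficients satisfy $\binom{m}{\ell}=0$ whenever $\ell<0$ or $\ell>m$. The Eulerian number of type $A$, $\left\langle{m\atop k}\right\rangle$ ($m\ge1$, $0\le k\le m-1$), is the number of permutations of $\{1,\dots,m\}$ with exactly $k$ descents; equivalently $\sum_{j\ge0}(j+1)^m x^j=(1-x)^{-m-1}\sum_{k=0}^{m-1}\left\langle{m\atop k}\right\rangle x^k$ for $|x|<1$. The Eulerian number of type $B$, $\left\langle{m\atop k}\right\rangle^{B}$ ($m\ge0$, $0\le k\le m$), is determined by $\sum_{j\ge0}(2j+1)^m x^j=(1-x)^{-m-1}\sum_{k=0}^{m}\left\langle{m\atop k}\right\rangle^{B} x^k$ for $|x|<1$. For $n\in\mathbb N$ and $0\le t\le n-1$ let $$\mathcal C^{(B)}_{n,t}:=\sum_{k=0}^{n-1}\left\langle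 {2n-1 \atop k}\right\rangle^{B}(-1)^{k}\sum_{i=0}^{k}(-1)^i\binom{k}{i}\binom{2n-2k-1}{2t-2i+1},\quad \mathcal C^{(A)}_{n,t}:=\sum_{k=0}^{n-1}\left\langle {2n \atop k}\right\rangle(-1)^{k}\sum_{i=0}^{k}(-1)^i\binom{k}{i}\binom{2n-2k-1}{2t-2i+1},$$ $$\Xi_n(x):=\frac{(-1)^{n+1}}{2^{4n-2}(2n-1)!}\sum_{t=0}^{n-1}\mathcal C^{(B)}_{n,t}\,x^{2t},\qquad \Lambda_n(x):=\frac{2(-1)^{n+1}}{(2^{2n+1}-1)(2n)!}\sum_{t=0}^{n-1}\mathcal C^{(A)}_{n,t}\,x^{2t}.$$ *)

(* Defs.v *)
From mathcomp Require Import all_boot all_order all_fingroup all_algebra.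
From mathcomp Require Import all_classical all_reals all_analysis.
Import Order.TTheory GRing.Theory Num.Theory numFieldNormedType.Exports.

Set Implicit Arguments.
Unset Strict Implicit.
Unset Printing Implicit Defensive.

Local Open Scope classical_set_scope.
Local Open Scope ring_scope.

(* A descent of s is recorded as the pair (p, p + 1) of adjacent positions. *)
Definition descents (m : nat) (s : 'S_m) : nat :=
  #|[set p : 'I_m * 'I_m |
      (p.2 == p.1.+1 :> nat) && (s p.2 < s p.1)%N]%SET|.

Definition eulerianA (m k : nat) : nat :=
  #|[set s : 'S_m | descents s == k]%SET|.

(* P is the numerator of the generating function
     \sum_(j >= 0) (2 j + 1)^m x^j = (1 - x)^(- m - 1) * P(x),   |x| < 1. *)
Definition eulerianB_gf (R : realType) (m : nat) (P : {poly int}) : Prop :=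
  (size P <= m.+1)%N /\
  forall x : R, `|x| < 1 ->
    series (fun j : nat => (2 * j + 1)%:R ^+ m * x ^+ j) @ \oo -->
      (1 - x) ^- m.+1 * \sum_(k < m.+1) (P`_k)%:~R * x ^+ k.

(* The equation above has exactly one solution P; the default value 0 of xget
   is not a solution, since the series is 1 at x = 0. *)
Definition eulerianB (R : realType) (m k : nat) : int :=
  (xget 0 [set P : {poly int} | eulerianB_gf R m P])`_k.

(* Binomial coefficient with an integer lower index, 0 when it is negative. *)
Definition binz (m : nat) (l : int) : nat :=
  if l is Posz l' then 'C(m, l') else 0%N.

(* The upper index 2 n - 2 k - 1 is a natural number because k < n. *)
Definition eulerian_sum (e : nat -> int) (n t : nat) : int :=
  \sum_(k < n) e k * (-1) ^+ k *
    \sum_(i < k.+1) (-1) ^+ i * ('C(k, i))%:Z *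
      (binz (2 * n - 2 * k - 1)%N (2 * t%:Z - 2 * i%:Z + 1))%:Z.

Definition CB (R : realType) (n t : nat) : int :=
  eulerian_sum (eulerianB R (2 * n - 1)) n t.

Definition CA (n t : nat) : int :=
  eulerian_sum (fun k => (eulerianA (2 * n) k)%:Z) n t.

Definition Xi (R : realType) (n : nat) : {poly rat} :=
  ((-1) ^+ n.+1 / (2 ^+ (4 * n - 2) * ((2 * n - 1)`!)%:R)) *:
    \sum_(t < n) (CB R n t)%:~R *: 'X^(2 * t).

Definition Lambda (n : nat) : {poly rat} :=
  (2 * (-1) ^+ n.+1 / ((2 ^+ (2 * n + 1) - 1) * ((2 * n)`!)%:R)) *:
    \sum_(t < n) (CA n t)%:~R *: 'X^(2 * t).

(* Main.v *)
Require Import Defs.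
From mathcomp Require Import all_boot all_order all_fingroup all_algebra.
From mathcomp Require Import all_classical all_reals all_analysis.
From mathcomp Require Import ring lra zify.
Import Order.TTheory GRing.Theory Num.Theory numFieldNormedType.Exports.
Local Open Scope ring_scope.

(** For t = n - 1 the lower index 2t - 2i + 1 = 2n - 2i - 1 of the inner
    binomial coefficient exceeds the upper one, 2n - 2k - 1, unless i = k, where
    the coefficient is 1.  The two signs (-1)^k cancel, so the top coefficient is
    the sum of the first n Eulerian numbers of a row of length 2n
    ([eulerian_sum_top]).  Each row is palindromic, so this is half of the
    row sum ([sum_half]), and the row sum is (2n)! in type A and
    2^(2n-1) (2n-1)! in type B.

    In type A the row sum counts all permutations, and the palindrome comes from
    reversing the order of the values, which exchanges descents and ascents
    ([eulerianA_sym], [sum_eulerianA]).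

    In type B everything is read off the recurrence
      P_0 = 1,   P_(m+1) = (1 + (2m+1) X) P_m + 2 X (1 - X) P_m',
    which makes the sum P_m(1) = 2^m m! and the palindrome immediate
    ([iterB_at1], [coef_iterB_sym]).  That this P_m is the numerator of
    sum_j (2j+1)^m x^j rests on one exact identity: the recurrence is linear in
    P, and starting it from 1 - X^N instead of 1 gives (1 - X)^(m+1) times the
    N-th partial sum ([iterB_truncation]).  By linearity the error is the image
    of X^N; it tends to 0 on |x| < 1 because all derivatives of X^N do
    ([derivs_cvg0_Xn], [derivs_cvg0_iterB]).  A numerator is unique, since two of
    them agree on infinitely many points ([eulerianB_gf_unique]). *)

(** * The recurrence for type B numerators *)

(** With F = p / (1 - X)^(m+1), the polynomial [stepB m p] is the numerator of
    F + 2 X F' over (1 - X)^(m+2); on power series F |-> F + 2 X F' multiplies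
    the j-th coefficient by 2j + 1. *)
Definition stepB (R : comNzRingType) (m : nat) (p : {poly R}) : {poly R} :=
  (1 + 'X *+ (2 * m).+1) * p + ('X * (1 - 'X) * p^`()) *+ 2.

Fixpoint iterB (R : comNzRingType) (m : nat) (p : {poly R}) : {poly R} :=
  if m is m'.+1 then stepB R m' (iterB R m' p) else p.

Arguments stepB {R}. Arguments iterB {R}.

Lemma iterB_sub (R : comNzRingType) m (p q : {poly R}) :
  iterB m (p - q) = iterB m p - iterB m q.
Proof. by elim: m => //= m ->; rewrite /stepB derivB; ring. Qed.

Lemma map_iterB (R S : comNzRingType) (f : {rmorphism R -> S}) m (p : {poly R}) :
  map_poly f (iterB m p) = iterB m (map_poly f p).
Proof.
elim: m => //= m <-; rewrite /stepB deriv_map.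
by rewrite !(rmorphB, rmorphD, rmorphM, rmorphMn, rmorph1) /= map_polyX.
Qed.

Lemma coef_stepB (R : comNzRingType) m (p : {poly R}) k :
  (stepB m p)`_k = (2 * k + 1)%:R * p`_k +
    (if k is k'.+1 then ((2 * m + 1)%:R - (2 * k')%:R) * p`_k' else 0).
Proof.
have -> : stepB m p = p + ('X * p) *+ (2 * m).+1 + ('X * p^`() - 'X * ('X * p^`())) *+ 2.
  by rewrite /stepB; ring.
rewrite !(coefD, coefN, coefMn, coefXM).
case: k => [|[|k]] /=; rewrite ?coef_deriv; ring.
Qed.

Lemma coef_stepB0 (R : comNzRingType) m (p : {poly R}) : (stepB m p)`_0 = p`_0.
Proof. by rewrite coef_stepB mul1r addr0. Qed.

Lemma coef_stepBS (R : comNzRingType) m (p : {poly R}) k :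
  (stepB m p)`_k.+1 = (2 * k + 3)%:R * p`_k.+1 + ((2 * m + 1)%:R - (2 * k)%:R) * p`_k.
Proof. by rewrite coef_stepB; congr (_%:R * _ + _); lia. Qed.

Lemma size_stepB (R : comNzRingType) m (p : {poly R}) :
  (size p <= m.+1)%N -> (size (stepB m p) <= m.+2)%N.
Proof.
move=> /leq_sizeP sp; apply/leq_sizeP => j mj.
case: j mj => [|[|j]] // mj.
rewrite coef_stepBS !sp ?mulr0 ?addr0 //; lia.
Qed.

Lemma size_iterB (R : comNzRingType) m : (size (iterB m (1 : {poly R})) <= m.+1)%N.
Proof. by elim: m => [|m IHm] /=; [rewrite size_poly1|exact: size_stepB]. Qed.

Lemma stepB_pow (R : comNzRingType) m (S : {poly R}) :
  stepB m ((1 - 'X) ^+ m.+1 * S) = (1 - 'X) ^+ m.+2 * (S + ('X * S^`()) *+ 2).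
Proof.
rewrite /stepB derivM deriv_exp derivB derivX -polyC1 derivC polyC1 /= !exprS; ring.
Qed.

(** Started from 1 - X^N = (1 - X) (1 + X + ... + X^(N-1)), the recurrence
    keeps track of a truncated series exactly, with no error term. *)
Lemma iterB_truncation (R : comNzRingType) m N :
  iterB m (1 - 'X^N : {poly R}) =
  (1 - 'X) ^+ m.+1 * \sum_(j < N) 'X^j *+ (2 * j + 1) ^ m.
Proof.
elim: m => [|m IHm] /=.
  by rewrite -opprB subrX1 -mulNr opprB.
rewrite IHm stepB_pow; congr (_ * _).
rewrite raddf_sum mulr_sumr -sumrMnl -big_split; apply: eq_bigr => j _ /=.
rewrite derivMn derivXn.
have -> : 'X * ('X^(j.-1) *+ j *+ (2 * j + 1) ^ m) =
          'X^j *+ j *+ (2 * j + 1) ^ m :> {poly R}.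
  by case: (nat_of_ord j) => [|i]; rewrite ?mulr0n ?mul0rn ?mulr0 //= !mulrnAr -exprS.
by rewrite -!mulrnA -mulrnDr expnSr; congr (_ *+ _); ring.
Qed.

(** * The generating function of type B *)

Local Open Scope classical_set_scope.

(** Pointwise convergence to 0 on ]-1, 1[ alone would not survive [stepB], which
    differentiates; requiring it of all derivatives gives a class that is stable
    under the recurrence. *)
Definition derivs_cvg0 (R : realType) (r : nat -> {poly R}) : Prop :=
  forall (k : nat) (x : R), `|x| < 1 -> ((r N)^`(k))%R.[x] @[N --> \oo] --> 0.

(** The k-th derivative of X^N at x is k! C(N, k) x^(N-k), and C(N, k) |x|^(N-k) h^k
    is a single term of the binomial expansion of (|x| + h)^N, a geometric
    sequence tending to 0 when |x| + h < 1. *)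
Lemma derivs_cvg0_Xn (R : realType) : derivs_cvg0 R (fun N => 'X^N).
Proof.
move=> k x x1; pose y := `|x|; pose h := (1 - y) / 2.
have y0 : 0 <= y by exact: normr_ge0.
have y1 : y < 1 by [].
have h0 : 0 < h by rewrite /h divr_gt0 ?subr_gt0.
(* The midpoint of |x| and 1 is the ratio of the dominating geometric sequence. *)
have z1 : `|y + h| < 1 by rewrite ger0_norm ?addr_ge0 ?(ltW h0) // /h; lra.
apply: norm_cvg0.
apply: (@squeeze_cvgr _ _ _ _ (fun=> 0) (fun N => (k`!)%:R / h ^+ k * (y + h) ^+ N)).
- near=> N; rewrite normr_ge0 /= derivnXn hornerMn hornerXn normrMn normrX -/y.
  rewrite -bin_ffact mulrnA -[leLHS]mulr_natl -mulrA ler_wpM2l ?ler0n //.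
  rewrite mulrC ler_pdivlMr ?exprn_gt0 //.
  have [kN|Nk] := leqP k N; last first.
    by rewrite bin_small // mulr0n mul0r exprn_ge0 // addr_ge0 // ltW.
  rewrite exprDn (bigD1 (Ordinal (kN : (k < N.+1)%N))) //= mulrnAl lerDl.
  by apply: sumr_ge0 => i _; rewrite mulrn_wge0 // mulr_ge0 // exprn_ge0 // ltW.
- exact: cvg_cst.
- rewrite -[X in _ --> X](mulr0 ((k`!)%:R / h ^+ k)).
  by apply: cvgMl_tmp; exact: cvg_expr.
Unshelve. all: by end_near.
Qed.

Lemma derivs_cvg0_deriv (R : realType) (r : nat -> {poly R}) :
  derivs_cvg0 R r -> derivs_cvg0 R (fun N => ((r N)^`())%R).
Proof.
move=> rn k x x1.
rewrite (_ : (fun N => _) = (fun N => ((r N)^`(k.+1))%R.[x])); first exact: rn.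
by apply/funext => N; rewrite derivSn.
Qed.

Lemma derivs_cvg0_add (R : realType) (r s : nat -> {poly R}) :
  derivs_cvg0 R r -> derivs_cvg0 R s -> derivs_cvg0 R (fun N => r N + s N).
Proof.
move=> rn sn k x x1.
rewrite (_ : (fun N => _) =
  (fun N => ((r N)^`(k))%R.[x]) + (fun N => ((s N)^`(k))%R.[x])).
  by rewrite -[X in _ --> X](addr0 0); apply: cvgD; [exact: rn|exact: sn].
by apply/funext => N; rewrite derivnD hornerD.
Qed.

Lemma derivs_cvg0_mul (R : realType) (p : {poly R}) (r : nat -> {poly R}) :
  derivs_cvg0 R r -> derivs_cvg0 R (fun N => p * r N).
Proof.
move=> rn k; elim: k p r rn => [|k IHk] p r rn x x1.
  rewrite (_ : (fun N => _) = (fun N => p.[x] * ((r N)^`(0))%R.[x])).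
    by rewrite -[X in _ --> X](mulr0 p.[x]); apply: cvgMl_tmp; exact: rn.
  by apply/funext => N; rewrite !derivn0 hornerM.
rewrite (_ : (fun N => _) =
  (fun N => (((p^`())%R * r N)^`(k))%R.[x]) +
  (fun N => ((p * (r N)^`())%R^`(k))%R.[x])).
  rewrite -[X in _ --> X](addr0 0); apply: cvgD; first exact: IHk.
  by apply: IHk => //; exact: derivs_cvg0_deriv.
by apply/funext => N; rewrite derivSn derivM derivnD hornerD.
Qed.

Lemma derivs_cvg0_iterB (R : realType) m (r : nat -> {poly R}) :
  derivs_cvg0 R r -> derivs_cvg0 R (fun N => iterB m (r N)).
Proof.
move=> rn; elim: m => //= m IHm; apply: derivs_cvg0_add.
  exact: derivs_cvg0_mul.
have dm := derivs_cvg0_mul R ('X * (1 - 'X)) _ (derivs_cvg0_deriv _ _ IHm).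
exact: (derivs_cvg0_add _ _ _ dm dm).
Qed.

Lemma eulerianB_gf_iterB (R : realType) m : eulerianB_gf R m (iterB m 1).
Proof.
split=> [|x x1]; first exact: size_iterB.
have x0 : 1 - x != 0.
  by rewrite subr_eq0 eq_sym; apply: contraTneq x1 => ->; rewrite normr1 ltxx.
have -> : \sum_(k < m.+1) ((iterB m 1)`_k)%:~R * x ^+ k = (iterB m (1 : {poly R})).[x].
  rewrite (@horner_coef_wide _ m.+1) ?size_iterB //; apply: eq_bigr => k _.
  by rewrite -(rmorph1 (map_poly (intr : int -> R))) -map_iterB coef_map.
rewrite (_ : series _ = (fun N => (1 - x) ^- m.+1 *
  ((iterB m (1 : {poly R})).[x] - ((iterB m 'X^N)^`(0))%R.[x]))).
  apply: cvgMl_tmp; rewrite -[X in _ --> X]subr0; apply: cvgB; first exact: cvg_cst.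
  exact: (derivs_cvg0_iterB R m _ (derivs_cvg0_Xn R) 0%N x x1).
apply/funext => N; rewrite derivn0 -hornerN -hornerD -iterB_sub iterB_truncation.
rewrite hornerM horner_exp hornerD hornerN hornerX hornerC mulKf ?expf_neq0 //.
rewrite /series /= big_mkord horner_sum; apply: eq_bigr => j _.
by rewrite hornerMn hornerXn -natrX mulr_natl.
Qed.

Lemma eulerianB_gf_unique (R : realType) m (P Q : {poly int}) :
  eulerianB_gf R m P -> eulerianB_gf R m Q -> P = Q.
Proof.
move=> [sP gP] [sQ gQ].
have eqPQ (x : R) : `|x| < 1 -> (map_poly intr P).[x] = (map_poly intr Q).[x].
  move=> x1; have x0 : 1 - x != 0.
    by rewrite subr_eq0 eq_sym; apply: contraTneq x1 => ->; rewrite normr1 ltxx.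
  have E (p : {poly int}) : (size p <= m.+1)%N ->
      (map_poly intr p).[x] = \sum_(k < m.+1) (p`_k)%:~R * x ^+ k.
    move=> sp; rewrite (@horner_coef_wide _ m.+1) ?(leq_trans (size_poly _ _)) //.
    by apply: eq_bigr => k _; rewrite coef_map.
  rewrite !E //; apply: (mulfI (invr_neq0 (expf_neq0 m.+1 x0))).
  exact: norm_cvg_unique (gP x x1) (gQ x x1).
have : map_poly (intr : int -> R) P - map_poly intr Q = 0.
  set D := (X in X = 0); apply/eqP/negPn/negP => D0.
  (* The inverses of 2, 3, 4, ... provide more roots in ]-1, 1[ than the degree
     allows. *)
  pose rs := [seq (k.+2%:R : R)^-1 | k <- iota 0 (size D)].
  have /(max_poly_roots D0) : all (root D) rs.
    apply/allP => _ /mapP[k _ ->]; rewrite /root hornerD hornerN eqPQ ?subrr //.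
    by rewrite ger0_norm ?invr_ge0 ?ler0n // invf_lt1 ?ltr0n // ltr1n.
  have -> : uniq rs.
    rewrite map_inj_uniq ?iota_uniq // => i j /invr_inj /eqP; rewrite eqr_nat.
    by move=> /eqP [].
  by move=> /(_ isT); rewrite size_map size_iota ltnn.
move=> /subr0_eq PQ; apply/polyP => i.
have /eqP := congr1 (fun p : {poly R} => p`_i) PQ.
by rewrite !coef_map /= eqr_int => /eqP.
Qed.

Lemma eulerianBE (R : realType) m k : eulerianB R m k = (iterB m 1)`_k.
Proof.
rewrite /eulerianB (xget_unique _ (eulerianB_gf_iterB R m)) // => P gP.
exact: (eulerianB_gf_unique R m _ _ gP (eulerianB_gf_iterB R m)).
Qed.

Local Close Scope classical_set_scope.

(** * Symmetry and sum of the type B rows *)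

(** In coordinates the recurrence reads
    P_(m+1,k) = (2k+1) P_(m,k) + (2m+3-2k) P_(m,k-1); replacing k by m + 1 - k
    exchanges the two multipliers. *)
Lemma coef_iterB_sym m k : (k <= m)%N ->
  (iterB m (1 : {poly int}))`_(m - k) = (iterB m 1)`_k.
Proof.
elim: m k => [|m IHm] k; first by rewrite leqn0 => /eqP ->.
have top : (iterB m (1 : {poly int}))`_m.+1 = 0.
  by apply: nth_default; exact: size_iterB.
have ends : (iterB m (1 : {poly int}))`_m = (iterB m 1)`_0.
  by rewrite -[RHS]IHm // subn0.
case: k => [|k] km.
  rewrite subn0 /= coef_stepB0 coef_stepBS top mulr0 add0r.
  by rewrite ends; ring.
rewrite subSS /=.
have [->|kLm] : k = m \/ (k < m)%N by lia.
  by rewrite subnn coef_stepB0 coef_stepBS top ends; ring.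
have -> : (m - k = (m - k.+1).+1)%N by lia.
have e1 : (iterB m (1 : {poly int}))`_(m - k.+1).+1 = (iterB m 1)`_k.
  by rewrite -IHm ?(ltnW kLm) //; congr (_`_ _); lia.
have e2 : (2 * m + 1 = 2 * (m - k.+1) + 2 * k + 3)%N by lia.
by rewrite !coef_stepBS e1 IHm // e2; ring.
Qed.

(** At 1 the derivative term of the recurrence vanishes, which leaves
    P_(m+1)(1) = 2 (m+1) P_m(1). *)
Lemma iterB_at1 m : (iterB m (1 : {poly int})).[1] = 2 ^+ m * (m`!)%:Z.
Proof.
elim: m => [|m IHm] /=; first by rewrite hornerC.
rewrite /stepB !(hornerD, hornerN, hornerMn, hornerM, hornerX) hornerC IHm subrr.
rewrite factS exprS PoszM; ring.
Qed.

(** * Reduction to half of a palindromic row *)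

Lemma sum_half (e : nat -> int) n : (forall k, (k < n)%N -> e (2 * n - 1 - k)%N = e k) ->
  \sum_(k < 2 * n) e k = 2 * \sum_(k < n) e k.
Proof.
move=> es; rewrite mulSn mul1n big_split_ord /= mulrDl mul1r; congr (_ + _).
rewrite [RHS](reindex_inj rev_ord_inj); apply: eq_bigr => k _ /=.
rewrite -(es (n - k.+1)%N); last by have := ltn_ord k; lia.
by congr e; have := ltn_ord k; lia.
Qed.

Lemma top_index (n i : nat) : (i < n)%N ->
  2 * (n - 1)%N%:Z - 2 * i%:Z + 1 = (2 * n - 2 * i - 1)%N%:Z.
Proof. lia. Qed.

(** Only the term i = k of the inner sum survives, because
    C(2n-2k-1, 2n-2i-1) = 0 for i < k. *)
Lemma eulerian_sum_top e n : eulerian_sum e n (n - 1) = \sum_(k < n) e k.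
Proof.
apply: eq_bigr => -[k kn] _ /=; rewrite big_ord_recr big1 /= => [|i _].
  by rewrite top_index //= !binn !mulr1 add0r -mulrA -expr2 sqrr_sign mulr1.
rewrite top_index ?(ltn_trans (ltn_ord i)) //= [X in _ * Posz X]bin_small ?mulr0 //.
by have := ltn_ord i; lia.
Qed.

(** * Symmetry and sum of the type A rows *)

Lemma card_adjacent m : (0 < m)%N ->
  #|[set p : 'I_m * 'I_m | p.2 == p.1.+1 :> nat]%SET| = m.-1.
Proof.
case: m => // m _ /=.
rewrite -[RHS]card_ord -cardsT.
pose f (i : 'I_m) : 'I_m.+1 * 'I_m.+1 := (widen_ord (leqnSn m) i, lift ord0 i).
have fI : injective f by move=> i j [] ij _; exact/val_inj.
rewrite -(card_imset _ fI); apply: eq_card => -[i j]; rewrite !inE /=.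
apply/eqP/imsetP => [ji|[k _ [-> ->]]] //=.
have im : (i < m)%N by have := ltn_ord j; lia.
exists (Ordinal im) => //; congr pair; apply/val_inj => //=.
Qed.

Definition ascents {m : nat} (s : 'S_m) : nat :=
  #|[set p : 'I_m * 'I_m | (p.2 == p.1.+1 :> nat) && (s p.1 < s p.2)%N]%SET|.

Lemma descents_ascents m (s : 'S_m) : (0 < m)%N -> (descents s + ascents s = m.-1)%N.
Proof.
move=> m0; rewrite -(card_adjacent m m0) /descents /ascents -cardsUI.
rewrite (_ : (_ :&: _)%SET = finset.set0) ?cards0 ?addn0; last first.
  by apply/setP => p; rewrite !inE; lia.
apply: eq_card => p; rewrite !inE -andb_orr; case: eqP => //= p21.
rewrite -neq_ltn; apply/eqP => /val_inj /perm_inj e; move: p21; rewrite e; lia.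
Qed.

Definition rev_perm m : 'S_m := perm (@rev_ord_inj m).

Lemma descents_rev m (s : 'S_m) : descents (s * rev_perm m)%g = ascents s.
Proof.
apply: eq_card => -[i j]; rewrite !inE /= !permM !permE /=.
have := ltn_ord (s i); have := ltn_ord (s j); lia.
Qed.

(** Reversing the values of a permutation is an involution that turns its
    descents into ascents, and a permutation has m - 1 adjacent pairs in all. *)
Lemma eulerianA_sym m k : (k < m)%N -> eulerianA m (m - 1 - k) = eulerianA m k.
Proof.
move=> km; rewrite /eulerianA -(card_imset _ (mulIg (rev_perm m))).
apply: eq_card => s; rewrite inE.
have rr : (rev_perm m * rev_perm m = 1)%g.
  by apply/permP => i; rewrite permM !permE rev_ordK.
apply/imsetP/eqP => [[u] | sk].
  rewrite inE => /eqP uk ->; rewrite descents_rev.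
  by have := descents_ascents m u (leq_ltn_trans (leq0n _) km); lia.
exists (s * rev_perm m)%g; last by rewrite -mulgA rr mulg1.
rewrite inE descents_rev; apply/eqP.
by have := descents_ascents m s (leq_ltn_trans (leq0n _) km); lia.
Qed.

Lemma sum_eulerianA m : (0 < m)%N -> (\sum_(k < m) eulerianA m k = m`!)%N.
Proof.
move=> m0; rewrite -card_Sn -[RHS]sum1_card.
have dm (s : 'S_m) : (descents s < m)%N.
  by have := descents_ascents m s m0; lia.
rewrite (partition_big (fun s => Ordinal (dm s)) predT) //=.
by apply: eq_bigr => k _; rewrite sum1dep_card; apply: eq_card => s; rewrite !inE.
Qed.

(** * Leading coefficients *)

Lemma CB_top (R : realType) n : (0 < n)%N ->
  CB R n (n - 1) = 2 ^+ (2 * n - 2) * ((2 * n - 1)`!)%:Z.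
Proof.
move=> n0; rewrite /CB eulerian_sum_top.
under eq_bigr do rewrite eulerianBE.
set P := iterB _ _.
have sumP : \sum_(k < 2 * n) P`_k = 2 * (2 ^+ (2 * n - 2) * ((2 * n - 1)`!)%:Z).
  rewrite mulrA -exprS (_ : (2 * n - 2).+1 = 2 * n - 1)%N -?iterB_at1; last by lia.
  rewrite (@horner_coef_wide _ (2 * n)).
    by apply: eq_bigr => k _; rewrite expr1n mulr1.
  by rewrite (leq_trans (size_iterB _ _)) //; lia.
apply: (mulfI (_ : 2 != 0 :> int)); rewrite // -sumP sum_half // => k kn.
by apply: coef_iterB_sym; lia.
Qed.

Lemma CA_top n : (0 < n)%N -> 2 * CA n (n - 1) = ((2 * n)`!)%:Z.
Proof.
move=> n0; rewrite /CA eulerian_sum_top -(sum_half (fun k => (eulerianA (2 * n) k)%:Z)).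
  by rewrite -sum_eulerianA ?muln_gt0 // -(big_morph Posz PoszD (erefl _)).
by move=> k kn; rewrite eulerianA_sym //; lia.
Qed.

Lemma coef_even_sum (c : nat -> int) n : (0 < n)%N ->
  (\sum_(t < n) (c t)%:~R *: 'X^(2 * t) : {poly rat})`_(2 * n - 2) = (c (n - 1)%N)%:~R.
Proof.
case: n => // n _; rewrite coef_sum big_ord_recr /= big1 => [|t _].
  by rewrite coefZ coefXn subn1 (_ : 2 * n.+1 - 2 = 2 * n)%N ?eqxx ?mulr1 ?add0r //; lia.
rewrite coefZ coefXn; case: eqP => [|_]; last by rewrite mulr0.
by have := ltn_ord t; lia.
Qed.

Theorem proposition7p1 (R : realType) (n : nat) (hn : (0 < n)%N) :
  [/\ (Xi R n)`_(2 * n - 2) = (-1) ^+ n.+1 / 2 ^+ (2 * n),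
      (Lambda n)`_(2 * n - 2) = (-1) ^+ n.+1 / (2 ^+ (2 * n + 1) - 1),
      CB R n (n - 1) = 2 ^+ (2 * n - 2) * ((2 * n - 1)`!)%:Z
    & (CA n (n - 1))%:~R = ((2 * n)`!)%:R / 2 :> rat].
Proof.
have f0 m : (m`!)%:R != 0 :> rat by rewrite pnatr_eq0 -lt0n fact_gt0.
have two0 m : 2 ^+ m != 0 :> rat by rewrite expf_neq0.
have CAn : (CA n (n - 1))%:~R = ((2 * n)`!)%:R / 2 :> rat.
  have twice : 2 * (CA n (n - 1))%:~R = ((2 * n)`!)%:R :> rat.
    by have := congr1 (intr : int -> rat) (CA_top n hn); rewrite intrM.
  by rewrite -twice; field.
have CBn := CB_top R n hn.
split=> //.
- rewrite /Xi coefZ coef_even_sum // CBn intrM rmorphXn /=.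
  have -> : (4 * n - 2 = 2 * n + (2 * n - 2))%N by lia.
  by rewrite exprD; field; rewrite f0 !two0.
- rewrite /Lambda coefZ coef_even_sum // CAn.
  by field; rewrite f0 /= subr_eq0 gt_eqF // exprn_egt1 ?addn1.
Qed.
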